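(* The identity $\alpha(n, 3(n-3)) = 3$ is false in general: it fails for $n = 14$. More precisely, let $G$ be the graph with vertex set $\{1, \dots, 14\}$ whose neighborhoods are $N(1)=\{5,9,10,11\}$, $N(2)=\{6,9,11,12\}$, $N(3)=\{9,12,13,14\}$, $N(4)=\{8,9,10,13\}$, $N(5)=\{1,8,12,13,14\}$, $N(6)=\{2,7,8,10,14\}$, $N(7)=\{6,9,10,13,14\}$, $N(8)=\{4,5,6,11,12\}$, $N(9)=\{1,2,3,4,7\}$, $N(10)=\{1,4,6,7,12\}$, $N(11)=\{1,2,8,13,14\}$, $N(12)=\{2,3,5,8,10\}$, $N(13)=\{3,4,5,7,11\}$, $N(14)=\{3,5,6,7,11\}$. Then $G$ has $14$ vertices and $33 = 3(14-3)$ edges, and $a(G) > 3$.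
   Context: All graphs are finite, simple and undirected. For a graph $G$, let $A(G)$ be its adjacency matrix, $D(G)$ the diagonal matrix of vertex degrees, and $L(G) = D(G) - A(G)$ its Laplacian matrix. The eigenvalues of $L(G)$, counted with multiplicity, are $0 = a_1(G) \le a_2(G) \le \cdots \le a_n(G)$, where $n = |V(G)|$. The algebraic connectivity of $G$ is $a(G) = a_2(G)$. For positive integers $n, m$, $\alpha(n,m)$ denotes the maximum of $a(G)$ over all graphs $G$ with $n$ vertices and $m$ edges. *)

(* Defs.v *)
From mathcomp Require Import all_boot all_order all_algebra.
From mathcomp Require Import polyrcf.

Set Implicit Arguments.
Unset Strict Implicit.
Unset Printing Implicit Defensive.

Import Order.TTheory GRing.Theory Num.Theory.

Local Open Scope ring_scope.

(* A simple graph on n vertices is given by its set of edges, which are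
   unordered pairs of distinct vertices. *)
Definition sgraph (n : nat) : finType :=
  {E : {set {set 'I_n}} | [forall e in E, #|e| == 2%N]}.

Definition num_edges n (G : sgraph n) : nat := #|val G|.

Definition adjacent n (G : sgraph n) : rel 'I_n :=
  fun i j => [set i; j] \in val G.

Definition neighbors n (G : sgraph n) (i : 'I_n) : {set 'I_n} :=
  [set j | adjacent G i j].

Definition degree n (G : sgraph n) (i : 'I_n) : nat := #|neighbors G i|.

Section Laplacian.
Variables (R : rcfType) (n : nat) (G : sgraph n).

Definition adjacency_mx : 'M[R]_n := \matrix_(i, j) (adjacent G i j)%:R.

Definition degree_mx : 'M[R]_n := diag_mx (\row_i (degree G i)%:R).

Definition laplacian : 'M[R]_n := degree_mx - adjacency_mx.

End Laplacian.

(* The eigenvalues of A lying in R, in nondecreasing order, each repeated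
   according to its multiplicity as a root of the characteristic polynomial.
   For a symmetric matrix, such as a Laplacian, these are all n eigenvalues. *)
Definition eigenvalues (R : rcfType) n (A : 'M[R]_n) : seq R :=
  sort <=%R (flatten [seq nseq (mup x (char_poly A)) x
                     | x <- rootsR (char_poly A)]).

(* The second smallest Laplacian eigenvalue: entries are numbered from 0.
   The default value 0 is only reached when n < 2. *)
Definition algebraic_connectivity (R : rcfType) n (G : sgraph n) : R :=
  (eigenvalues (laplacian R G))`_1.

(* Laplacian eigenvalues are nonnegative, so starting the iterated maximum
   at 0 does not affect it when some graph with n vertices and m edges exists. *)
Definition alpha (R : rcfType) (n m : nat) : R :=
  \big[Num.max/0]_(G : sgraph n | num_edges G == m)
    algebraic_connectivity R G.

(* Main.v *)
Require Import Defs.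
From mathcomp Require Import all_boot all_order all_algebra.
From mathcomp Require Import polyrcf.
From mathcomp Require Import ring lra.

Import Order.TTheory GRing.Theory Num.Theory.

Local Open Scope ring_scope.

(** Let L be the Laplacian of a graph G on n > 0 vertices, and J the all-ones
    matrix of order n.  As L annihilates the all-ones vector, adding J to L
    moves one eigenvalue from 0 to n and leaves the others in place:
    X * chi(L + J) = (X - n) * chi(L), where chi is the characteristic
    polynomial ([char_poly_add_ones]).  Hence chi(L) = X * q, where every root
    of q is an eigenvalue of L + J.  Suppose that 0 <= mu and that L + J - mu is
    positive definite.  Then every root of q exceeds mu, so 0 is a simple root
    of chi(L) and every other root exceeds mu.  If moreover n is even, then q
    has odd degree n - 1, hence a root, and the second smallest root of chi(L)
    exists and exceeds mu ([algebraic_connectivity_gt]).  The parity of n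
    replaces the theorem that symmetric matrices have only real eigenvalues.

    For the given graph and mu = 3, Gaussian elimination on L + J - 3 meets 14
    positive pivots, which writes the quadratic form of this matrix as a
    positive combination of squares of 14 linear forms in echelon shape
    ([form_G14_sos], [form_G14_gt]).  The maximum alpha(14, 33) is at least the
    connectivity of this graph, so it differs from 3. *)

(** * Characteristic polynomial of a matrix plus the all-ones matrix *)

(** Both sides compute the determinant of the bordered matrix
    M = [1, v; u, X - A], where u and v are the all-ones column and row:
    clearing u with the first row leaves X - A - uv, while scaling the first
    column by X and clearing it with the last n columns, thanks to
    (X - A) u = X u, leaves the scalar X - vu. *)
Lemma char_poly_add_ones (R : comNzRingType) n (A : 'M[R]_n) :
    A *m const_mx 1 = 0 :> 'cV_n ->
  'X * char_poly (A + const_mx 1) = ('X - n%:R%:P) * char_poly A.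
Proof.
move=> A1.
pose u : 'cV[{poly R}]_n := const_mx 1; pose v : 'rV[{poly R}]_n := const_mx 1.
pose M := block_mx 1%:M v u (char_poly_mx A).
have cAu : char_poly_mx A *m u = 'X *: u.
  have -> : u = map_mx polyC (const_mx 1) by rewrite map_const_mx.
  by rewrite /char_poly_mx mulmxBl mul_scalar_mx -map_mxM A1 map_mx0 subr0.
have uv : u *m v = const_mx 1.
  by apply/matrixP=> i j; rewrite !mxE big_ord1 !mxE mulr1.
have vu : v *m u = n%:R%:M.
  apply/matrixP=> i j; rewrite !ord1 !mxE eqxx mulr1n.
  under eq_bigr do rewrite !mxE mulr1.
  by rewrite sumr_const card_ord.
have detl : \det M = char_poly (A + const_mx 1).
  have ML : block_mx 1%:M 0 (- u) 1%:M *m M =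
            block_mx 1%:M v 0 (char_poly_mx (A + const_mx 1)).
    rewrite mulmx_block !mul1mx !mul0mx !addr0 mulmx1 addNr mulNmx uv.
    rewrite /char_poly_mx map_mxD map_const_mx opprD addrC.
    by rewrite rmorph1 addrA.
  have /(congr1 determinant) := ML.
  by rewrite det_mulmx det_lblock det_ublock !det1 !mul1r.
have MR : M *m block_mx 'X%:M 0 (- u) 1%:M =
          block_mx ('X - n%:R)%:M v 0 (char_poly_mx A).
  rewrite mulmx_block !mulmx0 !add0r !mulmx1 mul1mx !mulmxN vu cAu.
  by rewrite mul_mx_scalar subrr raddfB.
have /(congr1 determinant) := MR.
rewrite det_mulmx det_lblock det_ublock !det_scalar1 det1 mulr1 detl mulrC.
by rewrite polyC_natr.
Qed.

(** * The sorted list of eigenvalues *)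

Section Eigenvalues.
Variable R : rcfType.

Lemma count_mem_eigenvalues n (A : 'M[R]_n) x :
  count_mem x (eigenvalues A) = mup x (char_poly A).
Proof.
have p0 : char_poly A != 0 by rewrite monic_neq0 ?char_poly_monic.
rewrite /eigenvalues (permP (permEl (perm_sort _ _))) count_flatten -map_comp.
rewrite (eq_map (g := fun y => if y == x then mup x (char_poly A) else 0%N)).
  have: uniq (rootsR (char_poly A)) by apply: uniq_roots.
  have [->|mu] := eqVneq (mup x (char_poly A)) 0%N.
    by rewrite sumnE big_map; move=> _; apply: big1 => y _; case: ifP.
  move=> U; rewrite sumnE big_map -big_mkcond /= (big_rem x) /=.
    rewrite eqxx big_seq_cond big1 ?addn0 // => y /andP[].
    by rewrite mem_rem_uniq // inE => /andP[/negPf->].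
  have := roots_on_rootsR p0 x; rewrite inE /= => <-.
  by apply: contraNT mu => /mupNroot->.
move=> y /=; rewrite count_nseq /=.
by case: eqP => [->|_]; rewrite ?mul1n.
Qed.

Lemma mem_eigenvalues n (A : 'M[R]_n) x :
  (x \in eigenvalues A) = root (char_poly A) x.
Proof.
have p0 : char_poly A != 0 by rewrite monic_neq0 ?char_poly_monic.
rewrite -has_pred1 has_count count_mem_eigenvalues -XsubC_dvd //.
by rewrite dvdp_XsubCl.
Qed.

(** If the entry of index 1 were at most mu, then so would be the entry of
    index 0, and both would be 0; but 0 occurs only once.  The root of q is
    needed for the list to have two entries. *)
Lemma eigenvalues1_gt n (A : 'M[R]_n) (q : {poly R}) mu : 0 <= mu ->
    char_poly A = 'X * q -> (exists r, root q r) ->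
    (forall r, root q r -> mu < r) ->
  mu < (eigenvalues A)`_1.
Proof.
move=> mu0 Aq [r qr] qgt.
have q0 : ~~ root q 0 by apply/negP => /qgt; rewrite ltNge mu0.
have r0 : r != 0 by apply: contraNneq q0 => <-.
have rootA x : (x \in eigenvalues A) = (x == 0) || root q x.
  by rewrite mem_eigenvalues Aq rootM rootX.
have count0 : count_mem 0 (eigenvalues A) = 1%N.
  have := mup_XsubCX 1 0 (0 : R).
  by rewrite count_mem_eigenvalues Aq mupMl // subr0 eqxx.
have := sort_le_sorted (flatten [seq nseq (mup x (char_poly A)) x
                     | x <- rootsR (char_poly A)]).
rewrite -/(eigenvalues A).
have: 0 \in eigenvalues A by rewrite rootA eqxx.
have: r \in eigenvalues A by rewrite rootA qr orbT.
case: (eigenvalues A) rootA count0 => [|a [|b t]] //= rootA count0.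
  by rewrite !inE => /eqP ra /eqP a0; rewrite ra -a0 eqxx in r0.
move=> _ _ /andP[ab _]; rewrite ltNge; apply/negP => bmu.
have le_mu0 x : x \in [:: a, b & t] -> x <= mu -> x = 0.
  rewrite rootA => /orP[/eqP//|/qgt]; by rewrite ltNge => /negPf->.
have b0 : b = 0 by apply: le_mu0 => //; rewrite !inE eqxx orbT.
have a0 : a = 0 by apply: le_mu0 (le_trans ab bmu); rewrite inE eqxx.
by move: count0; rewrite a0 b0 eqxx.
Qed.

End Eigenvalues.

(** * A lower bound on the algebraic connectivity *)

Section Laplacian.
Variables (R : rcfType) (n : nat) (G : sgraph n).
Implicit Type v : 'rV[R]_n.

Lemma natr_degree i : (degree G i)%:R = \sum_j (adjacent G i j)%:R :> R.
Proof.
rewrite /degree -sum1_card natr_sum big_mkcond /=.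
by apply: eq_bigr => j _; rewrite inE; case: adjacent.
Qed.

Lemma laplacian_ones : laplacian R G *m const_mx 1 = 0 :> 'cV_n.
Proof.
apply/matrixP=> i j; rewrite mulmxBl mul_diag_mx !mxE mulr1 natr_degree.
by apply/eqP; rewrite subr_eq0; apply/eqP/eq_bigr => k _; rewrite !mxE mulr1.
Qed.

Lemma laplacian_form v : (v *m laplacian R G *m v^T) 0 0 =
  \sum_i \sum_(j | adjacent G i j) v 0 i * (v 0 i - v 0 j).
Proof.
rewrite -mulmxA mxE; apply: eq_bigr => i _.
rewrite mulmxBl mul_diag_mx !mxE natr_degree -mulr_sumr; congr (_ * _).
rewrite mulr_suml -sumrB [RHS]big_mkcond; apply: eq_bigr => j _ /=.
by rewrite !mxE; case: adjacent; rewrite ?mul1r ?mul0r ?subr0.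
Qed.

Lemma ones_form v : (v *m const_mx 1 *m v^T) 0 0 = (\sum_i v 0 i) ^+ 2.
Proof.
rewrite -mulmxA mxE expr2 mulr_suml; apply: eq_bigr => i _; congr (_ * _).
by rewrite mxE; apply: eq_bigr => j _; rewrite !mxE mul1r.
Qed.

Lemma sqr_form v : (v *m v^T) 0 0 = \sum_i v 0 i ^+ 2.
Proof. by rewrite mxE; apply: eq_bigr => i _; rewrite mxE. Qed.

Lemma sqr_form_gt0 v : v != 0 -> 0 < \sum_i v 0 i ^+ 2.
Proof.
move=> v0; rewrite lt0r sumr_ge0 ?andbT => [|i _]; last exact: sqr_ge0.
apply: contraNneq v0 => /psumr_eq0P v0; apply/eqP/rowP => i.
by apply/eqP; rewrite mxE -sqrf_eq0 v0 // => j _; apply: sqr_ge0.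
Qed.

(** The hypothesis on v says that L + J - mu is positive definite. *)
Lemma algebraic_connectivity_gt (mu : R) :
    (0 < n)%N -> ~~ odd n -> 0 <= mu ->
    (forall v, v != 0 -> mu * (\sum_i v 0 i ^+ 2) <
       \sum_i \sum_(j | adjacent G i j) v 0 i * (v 0 i - v 0 j)
         + (\sum_i v 0 i) ^+ 2) ->
  mu < algebraic_connectivity R G.
Proof.
move=> n_gt0 n_even mu0 gap.
have pE := char_poly_add_ones _ _ _ laplacian_ones.
have : root (char_poly (laplacian R G)) 0.
  have /(congr1 (horner^~ 0)) := pE.
  rewrite !hornerE => /esym/eqP; rewrite mulf_eq0 oppr_eq0 pnatr_eq0.
  by rewrite eqn0Ngt n_gt0.
move=> /factor_theorem[q]; rewrite subr0 mulrC => pq.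
have {}pE : char_poly (laplacian R G + const_mx 1) = ('X - n%:R%:P) * q.
  by apply: (mulfI (monic_neq0 (monicX R))); rewrite pE pq mulrCA.
have q0 : q != 0.
  apply: contraTneq (char_poly_monic (laplacian R G)) => q0.
  by rewrite pq q0 mulr0 monicE lead_coef0 eq_sym oner_eq0.
have size_q : size q = n.
  have := size_char_poly (laplacian R G).
  by rewrite pq mulrC size_mulX // => -[].
apply: eigenvalues1_gt mu0 pq _ _ => [|r qr].
  (* q has odd degree n - 1; [size] is the degree plus one. *)
  by have [|r qr] := @odd_poly_root _ q; [rewrite size_q | exists r].
have : eigenvalue (laplacian R G + const_mx 1) r.
  by rewrite eigenvalue_root_char pE rootM qr orbT.
case/eigenvalueP => v vr v0.
have := gap v v0.
rewrite -laplacian_form -ones_form.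
have -> : forall a b : 'M[R]_1, a 0 0 + b 0 0 = (a + b) 0 0.
  by move=> a b; rewrite mxE.
rewrite -mulmxDl -mulmxDr vr -scalemxAl [ltRHS]mxE sqr_form.
by rewrite ltr_pM2r ?sqr_form_gt0.
Qed.

End Laplacian.

(** * The simple graph of a symmetric irreflexive relation *)

Section SgraphOf.
Variables (n : nat) (e : rel 'I_n).

(** Restricting to increasing pairs makes each edge arise exactly once, so that
    edges can be counted as pairs. *)
Definition edge_set : {set {set 'I_n}} :=
  [set [set p.1; p.2] | p in [set p : 'I_n * 'I_n | e p.1 p.2 & (p.1 < p.2)%N]].

Lemma edge_set_card2 : [forall E in edge_set, #|E| == 2%N].
Proof.
apply/forall_inP => _ /imsetP[p + ->]; rewrite inE => /andP[_ p12].
rewrite cards2; suff -> : p.1 != p.2 by [].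
by rewrite -val_eqE ltn_eqF.
Qed.

Definition sgraph_of : sgraph n := exist _ edge_set edge_set_card2.

Lemma set2_inj (i j k l : 'I_n) :
  (i < j)%N -> (k < l)%N -> [set i; j] = [set k; l] -> (i, j) = (k, l).
Proof.
move=> ij kl /setP E; move: (E i) (E j).
rewrite !inE !eqxx orbT /= => /esym/orP[]/eqP ? /esym/orP[]/eqP ?; subst => //.
- by rewrite ltnn in ij.
- by have := ltn_trans ij kl; rewrite ltnn.
- by rewrite ltnn in ij.
Qed.

Lemma num_edges_sgraph_of :
  num_edges sgraph_of = (\sum_i \sum_(j | e i j && (i < j)) 1)%N.
Proof.
rewrite /num_edges card_in_imset => [|[i j] [k l]]; last first.
  by rewrite !inE => /andP[_ ij] /andP[_ kl]; apply: set2_inj.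
by rewrite -sum1dep_card pair_big_dep.
Qed.

Lemma adjacent_sgraph_of : symmetric e -> irreflexive e ->
  adjacent sgraph_of =2 e.
Proof.
move=> e_sym e_irr i j; apply/imsetP/idP => [[[k l]] | eij].
  rewrite inE /= => /andP[ekl kl]; have [ij|ji|/val_inj->] := ltngtP i j.
  - by case/(set2_inj _ _ _ _ ij kl) => -> ->.
  - by rewrite setUC => /(set2_inj _ _ _ _ ji kl)[-> ->]; rewrite e_sym.
  - move=> /setP E; move: (E k) (E l); rewrite !inE !eqxx orbT !orbb.
    by move=> /eqP jk /eqP jl; rewrite jk jl ltnn in kl.
have [ij|ji|/val_inj ij] := ltngtP i j.
- by exists (i, j); rewrite ?inE /= ?eij.
- by exists (j, i); [rewrite inE /= e_sym eij | rewrite setUC].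
- by rewrite ij e_irr in eij.
Qed.

End SgraphOf.

(** * The graph on 14 vertices *)

Definition nbr_table : seq (seq nat) :=
  [:: [:: 5; 9; 10; 11]%N;
      [:: 6; 9; 11; 12]%N;
      [:: 9; 12; 13; 14]%N;
      [:: 8; 9; 10; 13]%N;
      [:: 1; 8; 12; 13; 14]%N;
      [:: 2; 7; 8; 10; 14]%N;
      [:: 6; 9; 10; 13; 14]%N;
      [:: 4; 5; 6; 11; 12]%N;
      [:: 1; 2; 3; 4; 7]%N;
      [:: 1; 4; 6; 7; 12]%N;
      [:: 1; 2; 8; 13; 14]%N;
      [:: 2; 3; 5; 8; 10]%N;
      [:: 3; 4; 5; 7; 11]%N;
      [:: 3; 5; 6; 7; 11]%N].

(** The table numbers vertices from 1, and ordinals start at 0. *)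
Definition nbr : rel 'I_14 := fun i j => j.+1 \in nth [::] nbr_table i.

Definition G14 : sgraph 14 := sgraph_of 14 nbr.

Lemma nbr_sym : symmetric nbr.
Proof.
have : all (fun i => all (fun j =>
    (j.+1 \in nth [::] nbr_table i) == (i.+1 \in nth [::] nbr_table j))
  (iota 0 14)) (iota 0 14).
  by [].
move=> /allP H i j; apply/eqP.
by have /H /allP/(_ j) -> : val i \in iota 0 14; rewrite // mem_iota ltn_ord.
Qed.

Lemma nbr_irr : irreflexive nbr.
Proof.
have : all (fun i => i.+1 \notin nth [::] nbr_table i) (iota 0 14) by [].
move=> /allP H i; apply/negbTE/H.
by rewrite mem_iota ltn_ord.
Qed.

Lemma adjacent_G14 : adjacent G14 =2 nbr.
Proof. exact: adjacent_sgraph_of nbr_sym nbr_irr. Qed.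

Lemma num_edges_G14 : num_edges G14 = 33%N.
Proof.
rewrite num_edges_sgraph_of.
under eq_bigr => i _.
  rewrite -(big_mkord (fun j => (j.+1 \in nth [::] nbr_table i) && (i < j)%N)
    (fun=> 1%N)).
  over.
rewrite -(big_mkord xpredT (fun i => \sum_(0 <= j < 14 |
  (j.+1 \in nth [::] nbr_table i) && (i < j)%N) 1)%N).
by rewrite unlock.
Qed.

(** * Positive definiteness for the graph on 14 vertices *)

Lemma weighted_squares_gt0 (R : realDomainType) (s : seq (R * R)) :
    all (fun p => 0 < p.1) s -> has (fun p => p.2 != 0) s ->
  0 < \sum_(p <- s) p.1 * p.2 ^+ 2.
Proof.
elim: s => //= p s IHs /andP[p1 s1]; rewrite big_cons.
have s_ge0 : 0 <= \sum_(q <- s) q.1 * q.2 ^+ 2.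
  rewrite big_seq sumr_ge0 // => q /(allP s1) q1.
  by rewrite mulr_ge0 ?sqr_ge0 // ltW.
case/orP => [p2|/(IHs s1)].
  by rewrite ltr_pwDl // mulr_gt0 // lt0r sqrf_eq0 p2 sqr_ge0.
by apply: ltr_wpDl; rewrite mulr_ge0 ?sqr_ge0 // ltW.
Qed.

(** The pairs (w, l) such that the sum of the w * l ^ 2 is the quadratic form of
    L + J - 3, found by Gaussian elimination in the given order of the
    variables.  If d is a pivot and its row, divided by d, has least common
    denominator s, then l is that row times s and w = d / s ^ 2. *)
Definition pivot_squares (R : realFieldType) (x : nat -> R) : seq (R * R) :=
  [::
    (1 / 2, 2 * x 0%N + x 1%N + x 2%N + x 3%N + x 5%N + x 6%N + x 7%N + x 11%N
      + x 12%N + x 13%N);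
    (1 / 6, 3 * x 1%N + x 2%N + x 3%N + 2 * x 4%N - x 5%N + x 6%N + x 7%N
      + 2 * x 9%N - x 11%N + x 12%N + x 13%N);
    (1 / 12, 4 * x 2%N + x 3%N + 2 * x 4%N + 2 * x 5%N + x 6%N + x 7%N
      + 2 * x 9%N + 3 * x 10%N - x 11%N - 2 * x 12%N - 2 * x 13%N);
    (1 / 20, 5 * x 3%N + 2 * x 4%N + 2 * x 5%N + x 6%N - 3 * x 7%N - 2 * x 9%N
      + 3 * x 10%N + 3 * x 11%N - 2 * x 12%N + 2 * x 13%N);
    (1 / 45, 9 * x 4%N + 4 * x 5%N + 2 * x 6%N - x 7%N + 5 * x 8%N + x 9%N
      + x 10%N + x 11%N + x 12%N - x 13%N);
    (1 / 117, 13 * x 5%N - 7 * x 6%N - x 7%N + 5 * x 8%N + x 9%N + x 10%N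
      + x 11%N + 10 * x 12%N - x 13%N);
    (1 / 286, 22 * x 6%N + 5 * x 7%N + x 8%N - 5 * x 9%N + 8 * x 10%N
      + 8 * x 11%N + 2 * x 12%N - 8 * x 13%N);
    (1 / 814, 37 * x 7%N + 25 * x 8%N + 7 * x 9%N + 2 * x 10%N + 2 * x 11%N
      + 6 * x 12%N + 20 * x 13%N);
    (1 / 1998, 54 * x 8%N + 24 * x 9%N + 28 * x 10%N + 28 * x 11%N
      + 10 * x 12%N + 21 * x 13%N);
    (1 / 108, 12 * x 9%N + 5 * x 10%N + 5 * x 11%N + 5 * x 12%N + 6 * x 13%N);
    (1 / 132, 11 * x 10%N - x 11%N + 3 * x 12%N - 2 * x 13%N);
    (1 / 110, 10 * x 11%N + 3 * x 12%N - 2 * x 13%N);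
    (1 / 390, 13 * x 12%N - 2 * x 13%N);
    (11 / 26, x 13%N)].

Lemma form_G14_sos (R : realFieldType) (x : nat -> R) :
  \sum_(0 <= i < 14) \sum_(k <- nth [::] nbr_table i) x i * (x i - x k.-1)
    + (\sum_(0 <= i < 14) x i) ^+ 2 - 3 * (\sum_(0 <= i < 14) x i ^+ 2) =
  \sum_(p <- pivot_squares R x) p.1 * p.2 ^+ 2.
Proof. by rewrite unlock /=; field. Qed.

Lemma pivots_gt0 (R : realFieldType) (x : nat -> R) :
  all (fun p => 0 < p.1) (pivot_squares R x).
Proof. by rewrite /= !divr_gt0 ?ltr0n. Qed.

(** The linear forms are in echelon shape, so back substitution from the last
    variable applies. *)
Lemma pivot_squares_eq0 (R : realFieldType) (x : nat -> R) i :
  (i < 14)%N -> all (fun p => p.2 == 0) (pivot_squares R x) -> x i = 0.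
Proof.
move=> lti /=.
do 14![case/andP => /eqP ?] => _.
have x13 : x 13%N = 0 by [].
have x12 : x 12%N = 0 by lra.
have x11 : x 11%N = 0 by lra.
have x10 : x 10%N = 0 by lra.
have x9 : x 9%N = 0 by lra.
have x8 : x 8%N = 0 by lra.
have x7 : x 7%N = 0 by lra.
have x6 : x 6%N = 0 by lra.
have x5 : x 5%N = 0 by lra.
have x4 : x 4%N = 0 by lra.
have x3 : x 3%N = 0 by lra.
have x2 : x 2%N = 0 by lra.
have x1 : x 1%N = 0 by lra.
have x0 : x 0%N = 0 by lra.
by move: lti; do 14![case: i => [|i] //].
Qed.

Lemma form_G14_gt (R : realFieldType) (x : nat -> R) :
    (exists2 i, (i < 14)%N & x i != 0) ->
  3 * (\sum_(0 <= i < 14) x i ^+ 2) <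
  \sum_(0 <= i < 14) \sum_(k <- nth [::] nbr_table i) x i * (x i - x k.-1)
    + (\sum_(0 <= i < 14) x i) ^+ 2.
Proof.
move=> [i lti xi]; rewrite -subr_gt0 form_G14_sos.
apply: weighted_squares_gt0; first exact: pivots_gt0.
have : ~~ all (fun p => p.2 == 0) (pivot_squares R x).
  by apply: contra_neqN xi => /pivot_squares_eq0->.
by rewrite -has_predC.
Qed.

(** Turns a sum over ordinals into a sum over an explicit list of numbers, on
    which big operators compute. *)
Lemma sum_nbr (V : nmodType) (F : nat -> V) (i : 'I_14) :
  \sum_(j | nbr i j) F j = \sum_(k <- nth [::] nbr_table i) F k.-1.
Proof.
rewrite -(big_mkord (fun j => j.+1 \in nth [::] nbr_table i)) -big_filter.
rewrite -(big_map predn xpredT F); congr (\sum_(j <- _) F j).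
have: all (fun i => [seq j <- iota 0 14 | j.+1 \in nth [::] nbr_table i]
                    == map predn (nth [::] nbr_table i)) (iota 0 14) by [].
by move=> /allP/(_ i) /[!mem_iota] /(_ (ltn_ord i)) /eqP.
Qed.

Lemma algebraic_connectivity_G14 (R : rcfType) :
  3 < algebraic_connectivity R G14.
Proof.
apply: algebraic_connectivity_gt => // v v0.
pose x k := v 0 (inord k).
have vx i : v 0 i = x i by rewrite /x inord_val.
under eq_bigr do rewrite vx.
under [X in X + _]eq_bigr => i _.
  rewrite (eq_bigl (nbr i)) => [|j]; last exact: adjacent_G14.
  under eq_bigr do rewrite !vx.
  rewrite (sum_nbr _ (fun k => x i * (x i - x k))).
  over.
under [X in _ + X ^+ 2]eq_bigr do rewrite vx.
have := form_G14_gt R x; rewrite !big_mkord; apply.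
by have /rV0Pn[i vi] := v0; exists i; rewrite -?vx.
Qed.

(* The vertex labelled k (1 <= k <= 14) is the ordinal of value k - 1. *)
Theorem mainTheorem2 (R : rcfType) :
  alpha R 14 (3 * (14 - 3)) <> 3 /\
  exists G : sgraph 14,
    [/\ forall i : 'I_14,
          neighbors G i =
            [set j : 'I_14 | j.+1 \in
              nth [::]
                [:: [:: 5; 9; 10; 11]%N;
                    [:: 6; 9; 11; 12]%N;
                    [:: 9; 12; 13; 14]%N;
                    [:: 8; 9; 10; 13]%N;
                    [:: 1; 8; 12; 13; 14]%N;
                    [:: 2; 7; 8; 10; 14]%N;
                    [:: 6; 9; 10; 13; 14]%N;
                    [:: 4; 5; 6; 11; 12]%N;
                    [:: 1; 2; 3; 4; 7]%N;
                    [:: 1; 4; 6; 7; 12]%N;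
                    [:: 1; 2; 8; 13; 14]%N;
                    [:: 2; 3; 5; 8; 10]%N;
                    [:: 3; 4; 5; 7; 11]%N;
                    [:: 3; 5; 6; 7; 11]%N] i],
        num_edges G = 33%N,
        33%N = (3 * (14 - 3))%N
      & 3 < algebraic_connectivity R G].
Proof.
have gap := algebraic_connectivity_G14 R.
split.
  apply/eqP; rewrite gt_eqF // (lt_le_trans gap) // /alpha.
  by apply: le_bigmax_cond; rewrite num_edges_G14.
exists G14; split=> // [i|]; last exact: num_edges_G14.
by apply/setP=> j; rewrite !inE adjacent_G14.
Qed.
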